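(* Let $\mathrm{Peak}^c_{\mathcal A(0)}(t)=0$ and, for $n\ge1$, let $\mathrm{Peak}^c_{\mathcal A(n)}(t)=\sum t^{\mathrm{peak}(\mathbf a)}$, where the sum is over all Abelian area sequences $\mathbf a$ of size $n$ for which $\Gamma_{\mathbf a}$ is connected. Then $\mathrm{Peak}^c_{\mathcal A(n)}(t)$ is real-rooted for all $n\ge0$.
   Context: Write $[n]=\{1,\dots,n\}$. An area sequence of size $n$ is a sequence $\mathbf a=(a_1,\dots,a_n)$ of nonnegative integers with $a_i<i$ for all $i$ and $a_i\le a_{i-1}+1$ for all $i\ge 2$. Each area sequence $\mathbf a$ defines a graph $\Gamma_{\mathbf a}$ (a unit interval graph) on $[n]$ with edges $\{j,i\}$ for $1\le j<i\le n$ with $i-a_i\le j$. A peak-edge of $\Gamma_{\mathbf a}$ is either an isolated vertex or an edge $\{i,j\}$, $i<j$, such that neither $\{i,j+1\}$ nor $\{i-1,j\}$ is an edge (pairs not contained in $[n]$ are not edges); $\mathrm{peak}(\mathbf a)$ is the number of peak-edges. An area sequence $\mathbf a$ of size $n$ is Abelian if every vertex $i\ne 1,n$ of $\Gamma_{\mathbf a}$ is adjacent to at least one of the vertices $1$ and $n$. A real polynomial is real-rooted if all its zeros are real; the zero polynomial counts as real-rooted. *)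

(* Defs.v *)
From mathcomp Require Import all_boot all_order all_algebra.
From mathcomp Require Import complex.
From mathcomp Require Import reals.
Set Implicit Arguments.
Unset Strict Implicit.
Unset Printing Implicit Defensive.
Import GRing.Theory Num.Theory.

(* Vertices are numbered from 0: the ordinal [i] stands for the vertex [i + 1]
   of {1, ..., n}, and [a i] for the entry a_(i+1).  Since a_i < i <= n, an
   area sequence of size n takes its values in {0, ..., n - 1}, so the area
   sequences of size n are the elements of [{ffun 'I_n -> 'I_n}] satisfying
   [area_sequence]. *)
Section AreaSequences.
Variables (n : nat) (a : {ffun 'I_n -> 'I_n}).

Definition area_sequence : bool :=
  [forall i, a i < i.+1] &&
  [forall i : 'I_n, forall j : 'I_n, (i == j.+1 :> nat) ==> (a i <= (a j).+1)].

(* On an area sequence the subtraction is never truncated, as [a i <= i]. *)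
Definition edge_lt (j i : 'I_n) : bool := (j < i) && (i - a i <= j).

Definition edge (i j : 'I_n) : bool := edge_lt i j || edge_lt j i.

Definition isolated (i : 'I_n) : bool := [forall j, ~~ edge i j].

(* An edge {i, j} with i < j is represented by the pair (i, j). *)
Definition peak_pair (e : 'I_n * 'I_n) : bool :=
  let: (i, j) := e in
  [&& i < j, edge i j,
      [forall k : 'I_n, (k == j.+1 :> nat) ==> ~~ edge i k] &
      [forall k : 'I_n, (k.+1 == i :> nat) ==> ~~ edge k j]].

Definition peak : nat := #|[set i | isolated i]| + #|[set e | peak_pair e]|.

(* The vertices 1 and n. *)
Definition extremal (i : 'I_n) : bool := (i == 0 :> nat) || (i.+1 == n).

Definition abelian_seq : bool :=
  [forall i, ~~ extremal i ==> [exists j, extremal j && edge i j]].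

Definition connected_graph : bool := [forall i, forall j, connect edge i j].

End AreaSequences.

Local Open Scope ring_scope.

Definition conn_peak_poly (R : realType) (n : nat) : {poly R} :=
  if n is 0 then 0
  else \sum_(a : {ffun 'I_n -> 'I_n} |
             [&& area_sequence a, abelian_seq a & connected_graph a])
         'X^(peak a).

Definition real_rooted (R : realType) (p : {poly R}) : Prop :=
  p = 0 \/
  forall z : R[i], root (map_poly (real_complex R) p) z -> z \is Num.real.

(* Main.v *)
Require Import Defs.
From mathcomp Require Import all_boot all_order all_algebra.
From mathcomp Require Import complex polyrcf zify ring lra.
From mathcomp Require Import reals trigo.
Set Implicit Arguments.
Unset Strict Implicit.
Unset Printing Implicit Defensive.
Import Order.TTheory GRing.Theory Num.Theory.

(* For n >= 2 encode an Abelian connected area sequence by m i = i - a i, and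
   put k = m (n - 1).  Then m vanishes below k, so its ascents lie in [k, n)
   and its positive values in [1, k]; lowering the latter by one, the union A
   of both sets is a subset of {0, ..., n - 1} of even size, in which the
   values are the smaller half and the ascents the larger half.  Every even
   subset arises exactly once, except for the n - 1 pairs {k - 1, k}, and
   peak a = |A| / 2 + 1.  Hence

     Peak^c_n (t) = t (E_n (t) - (n - 1) t),   E_n (t) = sum_s C(n, 2 s) t^s.

   At t = - tan^2 x with x = j pi / n, E_n takes the value
   cos (n x) / cos^n x = (-1)^j (1 + tan^2 x)^(n / 2), which for odd j
   dominates (n - 1) tan^2 x.  The second factor therefore alternates in sign
   at these points for 2 j < n, which yields all its roots but at most one. *)

(** * Real-rootedness of the closed form *)

Section RealRootedness.
Local Open Scope ring_scope.

Lemma real_rootedM (R : realType) (p q : {poly R}) :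
  real_rooted p -> real_rooted q -> real_rooted (p * q).
Proof.
move=> [->|hp] [->|hq]; rewrite ?mul0r ?mulr0; try by left.
by right=> z; rewrite rmorphM rootM => /orP[/hp|/hq].
Qed.

Lemma real_rooted_size_le2 (R : realType) (p : {poly R}) :
  (size p <= 2)%N -> real_rooted p.
Proof.
move=> sp; have [->|p0] := eqVneq p 0; [by left|right=> z].
have -> : p = (p`_0)%:P + p`_1 *: 'X.
  apply/polyP=> -[|[|i]]; rewrite coefD coefC coefZ coefX /=.
  - by rewrite mulr0 addr0.
  - by rewrite mulr1 add0r.
  - by rewrite mulr0 addr0 nth_default // (leq_trans sp).
rewrite rmorphD /= map_polyC map_polyZ /= map_polyX rootE !hornerE.
have [b0|b0] := eqVneq p`_1 0.
  rewrite b0 rmorph0 mul0r addr0 fmorph_eq0 => /eqP a0; case/eqP: p0.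
  apply/polyP=> -[|[|i]]; rewrite coef0 //.
  by rewrite nth_default // (leq_trans sp).
rewrite addrC addr_eq0 => /eqP e.
have -> : z = real_complex R (- p`_0 / p`_1).
  rewrite rmorphM fmorphV rmorphN -e mulrC mulKf //.
  by rewrite fmorph_eq0.
by rewrite complex_real.
Qed.

Lemma real_rooted_prod_XsubC (R : realType) (s : seq R) :
  real_rooted (\prod_(x <- s) ('X - x%:P)).
Proof.
elim: s => [|x s IH].
  by rewrite big_nil; apply: real_rooted_size_le2; rewrite size_poly1.
rewrite big_cons; apply: real_rootedM => //.
by apply: real_rooted_size_le2; rewrite size_XsubC.
Qed.

(* Dividing out the roots in [s] leaves a factor of degree at most one. *)
Lemma real_rooted_enough_roots (R : realType) (p : {poly R}) (s : seq R) :
  uniq s -> all (root p) s -> (size p <= (size s).+2)%N -> real_rooted p.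
Proof.
move=> us rs sp; have [->|p0] := eqVneq p 0; first by left.
have [|q pq] := uniq_roots_prod_XsubC rs; first by rewrite uniq_rootsE.
rewrite pq; apply: real_rootedM; last exact: real_rooted_prod_XsubC.
have q0 : q != 0 by apply: contraNneq p0 => q0; rewrite pq q0 mul0r.
apply: real_rooted_size_le2; move: sp; rewrite pq size_Mmonic //; last first.
  exact: monic_prod_XsubC.
by rewrite size_prod_XsubC addnS /= -addn2 addnC leq_add2l.
Qed.

(** The intermediate value theorem yields one root between consecutive points. The bound by [x m] is
    carried through the induction because the next root lies below [x m] and is thereby distinct
    from the earlier ones. *)
Lemma alternating_roots (R : rcfType) (p : {poly R}) (x : nat -> R) (m : nat) :
  (forall j, (j < m)%N -> x j.+1 < x j) ->
  (forall j, (j <= m)%N -> 0 < (-1) ^+ j * p.[x j]) ->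
  exists s, [/\ size s = m, uniq s, all (root p) s & all (> x m) s].
Proof.
elim: m => [|m IH] xdec alt; first by exists [::].
have [||s [ss us rs ms]] := IH; first by move=> j jm; apply: xdec; apply: ltnW.
  by move=> j jm; apply: alt; apply: leqW.
have lt := xdec m (ltnSn m).
have sgn : p.[x m.+1] * p.[x m] < 0.
  have := mulr_gt0 (alt _ (leqnn m.+1)) (alt m (leqnSn m)).
  rewrite exprS mulN1r !mulNr mulrACA -expr2 sqrr_sign mul1r.
  by rewrite oppr_gt0.
have [y /[!in_itv]/= /andP[xy yx] ry] := poly_ivtoo (ltW lt) sgn.
exists (y :: s); split => //=.
- by rewrite ss.
- rewrite us andbT; apply/negP=> /(allP ms) /=.
  by rewrite ltNge ltW.
- by rewrite ry.
- by rewrite xy; apply: sub_all ms => z /=; apply: lt_trans.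
Qed.

(** With [odd_binom], the two halves E and O of the binomial expansion: (1 + u)^n = E(u^2) + u
    O(u^2). *)
Definition even_binom (R : nzRingType) (n : nat) : {poly R} :=
  \poly_(i < n./2.+1) ('C(n, i.*2))%:R.

Definition odd_binom (R : nzRingType) (n : nat) : {poly R} :=
  \poly_(i < n./2.+1) ('C(n, i.*2.+1))%:R.

Lemma coef_even_binom (R : nzRingType) n i :
  (even_binom R n)`_i = ('C(n, i.*2))%:R.
Proof. by rewrite coef_poly; case: ifP => // h; rewrite bin_small //; lia. Qed.

Lemma coef_odd_binom (R : nzRingType) n i :
  (odd_binom R n)`_i = ('C(n, i.*2.+1))%:R.
Proof. by rewrite coef_poly; case: ifP => // h; rewrite bin_small //; lia. Qed.

Lemma even_binomS (R : nzRingType) n :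
  even_binom R n.+1 = even_binom R n + 'X * odd_binom R n.
Proof.
apply/polyP=> -[|i]; rewrite coefD coefXM !coef_even_binom ?addr0 ?double0 ?bin0 //=.
by rewrite coef_odd_binom doubleS binS natrD.
Qed.

Lemma odd_binomS (R : nzRingType) n :
  odd_binom R n.+1 = odd_binom R n + even_binom R n.
Proof.
by apply/polyP=> i; rewrite coefD !coef_odd_binom coef_even_binom binS natrD.
Qed.

(* De Moivre: the real and imaginary parts of [(1 + i tan x) ^ n]. *)
Lemma binom_tan (R : realType) (x : R) n : cos x != 0 ->
  cos x ^+ n * (even_binom R n).[- tan x ^+ 2] = cos (x *+ n) /\
  cos x ^+ n * (tan x * (odd_binom R n).[- tan x ^+ 2]) = sin (x *+ n).
Proof.
move=> cx; have ct : cos x * tan x = sin x by rewrite /tan mulrC divfK.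
elim: n => [|n [IHe IHo]].
  rewrite mulr0n cos0 sin0 /even_binom /odd_binom !horner_poly !big_ord1 /=.
  by rewrite !expr0 !mulr1 bin_small // !mulr0.
move: (tan x) ct IHe IHo => t ct IHe IHo.
rewrite mulrS cosD sinD -IHe -IHo -ct even_binomS odd_binomS.
by rewrite !hornerD !hornerM hornerX exprS; split; ring.
Qed.

(** Squaring (n - 1) y < (1 + y)^(n / 2) avoids half-integer exponents. The cubic truncation of the
    binomial expansion of (1 + y)^n is already large enough. *)
Lemma sqr_lt_oneD_exp (R : realFieldType) (y : R) n : (3 <= n)%N -> 0 <= y ->
  (n.-1%:R * y) ^+ 2 < (1 + y) ^+ n.
Proof.
case: n => [|[|[|n]]] // _ y0 /=.
have N0 : 0 <= n%:R :> R by rewrite ler0n.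
have: 1 + (n%:R + 3) * y + (n%:R + 3) * (n%:R + 2) / 2 * y ^+ 2
      + (n%:R + 3) * (n%:R + 2) * (n%:R + 1) / 6 * y ^+ 3 <= (1 + y) ^+ n.+3.
  elim: n N0 => [|n IH] N0.
    by rewrite le_eqVlt; apply/orP; left; apply/eqP; field.
  have n0 : 0 <= n%:R :> R by rewrite ler0n.
  rewrite [leRHS]exprS; apply: le_trans (ler_wpM2l _ (IH n0)); last by lra.
  rewrite -subr_ge0 -natr1; set N := n%:R in n0 *.
  (* Multiplying one truncation by 1 + y exceeds the next truncation by exactly this term. *)
  suff : 0 <= (N + 3) * (N + 2) * (N + 1) / 6 * y ^+ 4.
    by congr (0 <= _); field.
  by rewrite !mulr_ge0 ?exprn_ge0 ?invr_ge0; lra.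
apply: lt_le_trans; rewrite -[n.+2]addn2 natrD; set N := n%:R in N0 *.
rewrite -subr_gt0.
suff h : 0 < 1 + y * (N + 3 - (N + 2) * (N + 1) / 2 * y
             + (N + 3) * (N + 2) * (N + 1) / 6 * y ^+ 2).
  by apply: lt_le_trans h _; rewrite le_eqVlt; apply/orP; left; apply/eqP; field.
rewrite ltr_pwDl // mulr_ge0 //.
(* the quadratic factor has negative discriminant in y *)
have q : 0 <= (N + 2) * (N + 1) by rewrite mulr_ge0; lra.
set Q := (N + 2) * (N + 1) in q *.
have -> : (N + 3) * (N + 2) * (N + 1) = (N + 3) * Q by rewrite /Q; ring.
have Qle : Q <= (N + 3) ^+ 2 by rewrite /Q; nra.
have N3 : 0 < N + 3 by lra.
set M := N + 3 in N3 Qle *.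
(* The factor M completes the square in M y; the constant 5 / 8 is 1 minus the 9 / 24 that the
   square contributes. *)
rewrite -(pmulr_rge0 _ N3).
have -> : M * (M - Q / 2 * y + M * Q / 6 * y ^+ 2)
  = (M ^+ 2 - Q) + Q * ((M * y - 3 / 2) ^+ 2 / 6 + 5 / 8) by field.
apply: addr_ge0; first by rewrite subr_ge0.
by apply: mulr_ge0 => //; have := sqr_ge0 (M * y - 3 / 2); lra.
Qed.

Lemma angle_range (R : realType) (n j : nat) : (j.*2 < n)%N ->
  0 <= (pi : R) / n%:R *+ j < pi / 2.
Proof.
move=> jn; have nR : 0 < n%:R :> R by rewrite ltr0n; lia.
have pi0 := pi_gt0 R.
have -> : pi / n%:R *+ j = pi * (j%:R / n%:R) :> R.
  by rewrite -mulr_natr; ring.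
rewrite mulr_ge0 ?(ltW pi0) ?divr_ge0 ?ler0n // ltr_pM2l //.
by rewrite ltr_pdivrMr // mulrC ltr_pdivlMr // -natrM ltr_nat muln2.
Qed.

Definition peak_poly (R : nzRingType) n : {poly R} :=
  even_binom R n - n.-1%:R *: 'X.

Lemma peak_poly_alternates (R : realType) (n j : nat) : (j.*2 < n)%N ->
  0 < (-1) ^+ j * (peak_poly R n).[- tan (pi / n%:R *+ j) ^+ 2].
Proof.
move=> jn; set x := pi / n%:R *+ j.
have n0 : (0 < n)%N by lia.
have nR : 0 < n%:R :> R by rewrite ltr0n.
have pi0 := pi_gt0 R.
have /andP[x0 xpi] : 0 <= x < pi / 2 by apply: angle_range.
have cx : 0 < cos x by apply: cos_gt0_pihalf; rewrite xpi andbT; lra.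
have c0 := lt0r_neq0 cx.
have [E _] := binom_tan n c0.
have xn : x *+ n = pi *+ j.
  rewrite /x -mulrnA mulnC mulrnA -[pi / _ *+ n]mulr_natr divfK //.
  exact: lt0r_neq0.
have cj : cos (pi *+ j) = (-1) ^+ j :> R.
  rewrite -[_ *+ j]add0r (alternatingn (@cosDpi R)) cos0.
  by rewrite mulr1.
move: E; rewrite xn cj => E.
have y0 : 0 <= tan x ^+ 2 by apply: sqr_ge0.
have cy : cos x ^- 2 = 1 + tan x ^+ 2 by apply: cos2_tan2.
set y := tan x ^+ 2 in y0 cy E *.
have u0 : 0 < cos x ^- n by rewrite invr_gt0 exprn_gt0.
have Ee : (even_binom R n).[- y] = cos x ^- n * (-1) ^+ j.
  by rewrite -E mulKf // expf_neq0.
rewrite /peak_poly !hornerE Ee mulrDr mulrCA -expr2 sqrr_sign mulr1.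
(* For even j the first term is positive and the second nonnegative. An odd j forces n >= 3, as the
   growth estimate requires. *)
rewrite -mulrN opprK -signr_odd; case: (boolP (odd j)) => oj; last first.
  by rewrite expr0 mul1r ltr_pwDl // mulr_ge0 ?ler0n.
have n3 : (3 <= n)%N by lia.
have ny0 : 0 <= n.-1%:R * y by rewrite mulr_ge0 ?ler0n.
rewrite expr1 mulN1r subr_gt0 -(ltr_pXn2r (n := 2)) // ?nnegrE ?(ltW u0) //.
by rewrite exprVn -exprM mulnC exprM -exprVn cy sqr_lt_oneD_exp.
Qed.

Lemma peak_poly_real_rooted (R : realType) n : (2 <= n)%N ->
  real_rooted (peak_poly R n).
Proof.
move=> n2; pose x j : R := - tan (pi / n%:R *+ j) ^+ 2.
have nR : 0 < n%:R :> R by rewrite ltr0n; lia.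
have pi0 := pi_gt0 R.
have tan_ge0 z : 0 <= z < pi / 2 -> 0 <= tan (z : R).
  move=> /andP[z0 zpi]; rewrite divr_ge0 //.
    by apply: sin_ge0_pi; rewrite z0 /=; lra.
  by apply: cos_ge0_pihalf; apply/andP; split; lra.
(* The index [n.-1./2] is the largest j with 2 j < n; it falls short of the degree bound n / 2 by at
   most one. *)
have [||s [ss us rs _]] := @alternating_roots R (peak_poly R n) x n.-1./2.
- move=> j jn; have r1 := @angle_range R n j.+1 ltac:(lia).
  have r0 := @angle_range R n j ltac:(lia).
  rewrite /x ltrN2 ltr_pXn2r ?nnegrE ?tan_ge0 // ltr_tan ?in_itv /=.
  + by rewrite mulrSr ltrDl divr_gt0.
  + by apply/andP; split; lra.
  + by apply/andP; split; lra.
- by move=> j jn; apply: peak_poly_alternates; lia.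
apply: real_rooted_enough_roots us rs _; rewrite ss.
apply: leq_trans (_ : n./2.+1 <= _)%N; last by lia.
rewrite (leq_trans (size_polyD _ _)) // geq_max size_poly size_polyN.
by rewrite (leq_trans (size_scale_leq _ _)) // size_polyX; lia.
Qed.

End RealRootedness.

(** * Left endpoints and peaks *)

Section LeftEnds.
Variable n : nat.
Implicit Types (a m : {ffun 'I_n.+1 -> 'I_n.+1}) (i j x : 'I_n.+1).

(* The least vertex of the closed neighbourhood of [i]. *)
Definition left_end a : {ffun 'I_n.+1 -> 'I_n.+1} :=
  [ffun i : 'I_n.+1 => inord (i - a i)].

Lemma left_endE a i : left_end a i = i - a i :> nat.
Proof. by rewrite ffunE inordK // ltnS (leq_trans (leq_subr _ _)) // -ltnS. Qed.

(** Being an involution here, [left_end] serves as its own inverse when the sum over area sequences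
    is reindexed. *)
Lemma left_endK a : (forall i, a i <= i) -> left_end (left_end a) = a.
Proof. by move=> ai; apply/ffunP=> i; apply: val_inj; rewrite /= !left_endE subKn. Qed.

Definition nondecreasing_ffun m :=
  [forall i : 'I_n.+1, forall j : 'I_n.+1, (i <= j) ==> (m i <= m j)].

Lemma nondecreasing_ffunP m :
  reflect (forall i j, i <= j -> m i <= m j) (nondecreasing_ffun m).
Proof.
apply: (iffP 'forall_forallP) => h i j; last exact/implyP/h.
by move/implyP: (h i j).
Qed.

(** In order, the conjuncts translate area sequence, connected and Abelian. At i = 0 the truncated
    predecessor makes the second one say m 0 = 0. *)
Definition left_end_spec m :=
  [&& nondecreasing_ffun m, [forall i : 'I_n.+1, m i <= i.-1] &
      [forall i : 'I_n.+1, (i < m ord_max) ==> (m i == 0 :> nat)]].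

Lemma left_end_specP m :
  reflect [/\ forall i j, i <= j -> m i <= m j, forall i, m i <= i.-1 &
              forall i, i < m ord_max -> m i = 0 :> nat] (left_end_spec m).
Proof.
apply: (iffP and3P) => -[h1 h2 h3]; split.
- exact/nondecreasing_ffunP.
- exact/forallP.
- by move=> i /(implyP (forallP h3 i))/eqP.
- exact/nondecreasing_ffunP.
- exact/forallP.
- by apply/forallP=> i; apply/implyP=> /h3/eqP.
Qed.

Section Fixed.
Variable a : {ffun 'I_n.+1 -> 'I_n.+1}.
Hypothesis ai : forall i, a i <= i.
Let m := left_end a.

Lemma edge_ltE j i : edge_lt a j i = (j < i) && (m i <= j).
Proof. by rewrite /edge_lt left_endE. Qed.

(** The inequality a_i <= a_(i-1) + 1 is m (i - 1) <= m i; the general comparison follows by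
    induction on the distance. *)
Lemma area_sequenceE : area_sequence a = nondecreasing_ffun m.
Proof.
rewrite /area_sequence; have -> /= : [forall i : 'I_n.+1, a i < i.+1].
  by apply/forallP=> i; rewrite ltnS.
apply/'forall_forallP/nondecreasing_ffunP => h i j.
  move=> ij; have [d jd] : exists d, j = i + d :> nat by exists (j - i); lia.
  elim: d j jd {ij} => [|d IH] j jd.
    by rewrite (_ : j = i) //; apply: val_inj; rewrite /= jd addn0.
  pose k : 'I_n.+1 := inord (i + d).
  have kE : k = i + d :> nat by rewrite inordK //; have := ltn_ord j; lia.
  apply: leq_trans (IH k kE) _.
  have /implyP := h j k; rewrite kE jd addnS eqxx => /(_ isT).
  by rewrite !left_endE; have := ai k; have := ai j; lia.
apply/implyP=> /eqP ij; have := h j i.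
by rewrite !left_endE ij; have := ai i; have := ai j; lia.
Qed.

(** If m i = i > 0, monotonicity leaves no edge between the vertices below i and the others.
    Otherwise every i > 0 is adjacent to i - 1, which links it to 0. *)
Lemma connected_graphE : nondecreasing_ffun m ->
  connected_graph a = [forall i : 'I_n.+1, m i <= i.-1].
Proof.
move=> /nondecreasing_ffunP mono; apply/'forall_forallP/forallP => [h i|h].
  have [//|lt] := leqP (m i) i.-1.
  have mi : m i <= i by rewrite left_endE leq_subr.
  have cl : closed (edge a) [pred x : 'I_n.+1 | x < i].
    move=> x y; rewrite /edge !edge_ltE !inE => exy.
    have := mono i x; have := mono i y.
    by case/orP: exy => /andP[]; lia.
  by have := closed_connect cl (h ord0 i); rewrite !inE /=; lia.
have sym : symmetric (edge a) by move=> x y; rewrite /edge orbC.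
have csym := sym_connect_sym sym.
have to0 d i : i = d :> nat -> connect (edge a) ord0 i.
  elim: d i => [|d IH] i id; first by rewrite (_ : i = ord0) //; apply: val_inj.
  pose k : 'I_n.+1 := inord d.
  have kE : k = d :> nat by rewrite inordK //; have := ltn_ord i; lia.
  apply: connect_trans (IH k kE) (connect1 _).
  by rewrite /edge edge_ltE kE id ltnSn /=; have := h i; rewrite id /= => ->.
by move=> i j; apply: (@connect_trans _ _ ord0); [rewrite csym|]; apply: to0.
Qed.

(** An interior vertex i is adjacent to the first vertex iff m i = 0, and to the last iff
    [m ord_max <= i]. At both extremal vertices the implication on the right holds automatically. *)
Lemma abelian_seqE : 0 < n -> nondecreasing_ffun m -> (forall i, m i <= i.-1) ->
  abelian_seq a = [forall i : 'I_n.+1, (i < m ord_max) ==> (m i == 0 :> nat)].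
Proof.
move=> n0 /nondecreasing_ffunP mono mpred.
apply: eq_forallb => i; rewrite /extremal eqSS.
have mx := mpred ord_max; have mi := mpred i.
have lin := ltn_ord i.
have [i0|i0] /= := eqVneq (i : nat) 0; first by rewrite -leqn0; lia.
have [iN|iN] /= := eqVneq (i : nat) n.
  by apply/esym/implyP; rewrite /= in mx; lia.
have -> : [exists j : 'I_n.+1, ((j == 0 :> nat) || (j.+1 == n.+1)) && edge a i j]
  = (m i == 0 :> nat) || (m ord_max <= i).
  apply/existsP/idP => [[j]|/orP[m0|mxi]].
  - rewrite /edge !edge_ltE => /andP[/orP[/eqP j0|/eqP jN]].
      by rewrite j0; lia.
    have -> : j = ord_max by apply: val_inj => /=; lia.
    by rewrite /=; lia.
  - by exists ord0; rewrite /edge !edge_ltE /=; lia.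
  - by exists ord_max; rewrite /edge !edge_ltE /=; lia.
lia.
Qed.

Lemma left_end_specE : 0 < n ->
  [&& area_sequence a, abelian_seq a & connected_graph a] = left_end_spec m.
Proof.
move=> n0; rewrite area_sequenceE /left_end_spec.
have [mono|//] := boolP (nondecreasing_ffun m); rewrite connected_graphE //=.
rewrite andbC; have [/forallP mp|//] := boolP [forall i : 'I_n.+1, m i <= i.-1].
by rewrite abelian_seqE.
Qed.

(** Connectedness excludes isolated vertices. A peak-edge (i, j) is a value i of [m] together with
    the last index j at which it is taken, so the first projection is a bijection onto the image. *)
Lemma peakE : 0 < n -> left_end_spec m -> peak a = #|m @: setT|.
Proof.
move=> n0 /left_end_specP[mono mpred _]; rewrite /peak.
(* Index 1 also has left end 0, so the last index taking the value 0 is not 0 itself and gives a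
   genuine edge. *)
pose i1 : 'I_n.+1 := inord 1.
have i1E : i1 = 1 :> nat by rewrite inordK.
have m1 : m i1 = 0 :> nat by have := mpred i1; rewrite i1E; lia.
have pairE i j : peak_pair a (i, j) =
    [&& i < j, m j == i & [forall k : 'I_n.+1, (j < k) ==> (i < m k)]].
  rewrite /peak_pair /edge !edge_ltE; apply/and4P/and3P.
    case=> ij /orP[/andP[_ mj]|]; last by lia.
    move=> /forallP h1 /forallP h2.
    have mji : i <= m j.
      case: (posnP i) => [-> //|i0]; pose k : 'I_n.+1 := inord i.-1.
      have kE : k = i.-1 :> nat by rewrite inordK //; have := ltn_ord i; lia.
      by have := h2 k; rewrite !edge_ltE kE; lia.
    split=> //; first by rewrite -val_eqE /=; lia.
    apply/forallP=> k; apply/implyP=> jk; pose j1 : 'I_n.+1 := inord j.+1.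
    have j1E : j1 = j.+1 :> nat by rewrite inordK //; have := ltn_ord k; lia.
    have := h1 j1; have := mono j1 k; rewrite !edge_ltE j1E; lia.
  case=> ij /eqP mj /forallP h; have mjn : m j = i :> nat by rewrite mj.
  split=> //; first by lia.
    by apply/forallP=> k; have := h k; rewrite !edge_ltE; lia.
  by apply/forallP=> k; rewrite !edge_ltE; lia.
have -> : [set i | isolated a i] = set0.
  apply/setP=> i; rewrite !inE; apply/negP=> /forallP iso.
  case: (posnP i) => [i0|i0].
    by have := iso i1; rewrite /edge !edge_ltE i0 i1E m1.
  pose k : 'I_n.+1 := inord i.-1.
  have kE : k = i.-1 :> nat by rewrite inordK //; have := ltn_ord i; lia.
  have := iso k; have := mpred i; rewrite /edge !edge_ltE kE; lia.
rewrite cards0 add0n -(card_in_imset (f := fst)); last first.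
  move=> [i j] [i' j']; rewrite !inE !pairE /=.
  move=> /and3P[_ /eqP mj /forallP h] /and3P[_ /eqP mj' /forallP h'] ii.
  rewrite -{}ii in mj' h' *; congr pair; apply: val_inj => /=.
  by have := h j'; have := h' j; rewrite mj mj'; lia.
congr #|pred_of_set _|; apply/setP=> v; apply/imsetP/imsetP.
  case=> -[i j]; rewrite inE pairE /= => /and3P[_ /eqP mj _] ->.
  by exists j; rewrite ?inE.
case=> i _ vi.
have [j /eqP mj jmax] := @arg_maxnP _ i (fun j => m j == v) (@nat_of_ord _)
  (introT eqP (esym vi)).
exists (v, j); rewrite // inE pairE mj eqxx /=; apply/andP; split.
  have vj : v <= j.-1 by rewrite -mj.
  case: (posnP j) => [j0|]; last by lia.
  have v0 : m i1 = v by apply: val_inj; rewrite /= m1; lia.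
  by have := jmax i1; rewrite v0 eqxx i1E j0 => /(_ isT).
apply/forallP=> k; apply/implyP=> jk; have := mono j k (ltnW jk).
rewrite mj leq_eqVlt => /orP[/eqP vk|//].
by have := jmax k; rewrite -val_eqE /= vk eqxx => /(_ isT); lia.
Qed.

End Fixed.
End LeftEnds.

(** * Left endpoints and even subsets *)

Section Code.
Variable n : nat.
Implicit Types (m : {ffun 'I_n.+1 -> 'I_n.+1}) (i j x : 'I_n.+1).
Implicit Type A : {set 'I_n.+1}.

(** The truncated predecessor of 0 is 0, so 0 is never an ascent. *)
Definition ascents m : {set 'I_n.+1} := [set i : 'I_n.+1 | m (inord i.-1) < m i].

Definition pred_values m : {set 'I_n.+1} :=
  [set x : 'I_n.+1 | [exists i, m i == x.+1 :> nat]].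

Definition code m := pred_values m :|: ascents m.

Lemma inord_pred i : (inord i.-1 : 'I_n.+1) = i.-1 :> nat.
Proof. by rewrite inordK //; have := ltn_ord i; lia. Qed.

Lemma pred_valuesP m x :
  reflect (exists i, m i = x.+1 :> nat) (x \in pred_values m).
Proof.
by rewrite inE; apply: (iffP existsP) => -[i /eqP]; exists i => //; apply/eqP.
Qed.

Section Monotone.
Variable m : {ffun 'I_n.+1 -> 'I_n.+1}.
Hypothesis mono : forall i j, i <= j -> m i <= m j.
Hypothesis m0 : m ord0 = 0 :> nat.

Lemma ascents_inj : {in ascents m &, injective m}.
Proof.
suff lt i j : i \in ascents m -> j \in ascents m -> i < j -> m i < m j.
  move=> i j Ai Aj mij; apply: val_inj => /=.
  case: (ltngtP i j) => // [/(lt _ _ Ai Aj)|/(lt _ _ Aj Ai)];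
  by rewrite mij ltnn.
move=> _; rewrite inE => mj ij; apply: leq_ltn_trans mj; apply: mono.
by rewrite inord_pred; lia.
Qed.

(** The least index taking the value [m i] is an ascent; positivity keeps it away from 0. *)
Lemma value_at_ascent i : 0 < m i -> exists2 j, j \in ascents m & m j = m i.
Proof.
move=> mi; have [j /eqP mj jmin] := @arg_minnP _ i (fun j => m j == m i)
  (@nat_of_ord _) (eqxx _).
exists j => //; rewrite inE ltnNge; apply/negP=> le.
case: (posnP j) => [j0|j0].
  by move: mi; rewrite -mj (_ : j = ord0) ?m0 //; apply: val_inj.
have := jmin (inord j.-1); rewrite inord_pred => /(_ _)/implyP.
have -> : m (inord j.-1) == m i.
  by rewrite -mj -val_eqE /= eqn_leq le mono // inord_pred leq_pred.
by rewrite /=; lia.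
Qed.

Lemma imset_ffunE : m @: setT = ord0 |: m @: ascents m.
Proof.
apply/setP=> v; rewrite !inE; apply/imsetP/orP.
  case=> i _ ->; case: (posnP (m i)) => [mi0|/value_at_ascent[j Aj <-]].
    by left; apply/eqP/val_inj.
  by right; apply: imset_f.
case=> [/eqP ->|/imsetP[i _ ->]].
- by exists ord0; rewrite ?inE //; apply: val_inj.
- by exists i; rewrite ?inE.
Qed.

Lemma card_imset_ffun : #|m @: setT| = #|ascents m|.+1.
Proof.
rewrite imset_ffunE cardsU1 card_in_imset; last exact: ascents_inj.
rewrite (_ : ord0 \notin _) //; apply/imsetP=> -[j]; rewrite inE => lt mj.
by move: lt; rewrite -mj.
Qed.

(** Each positive value is taken at exactly one ascent. This is why codes have even size. *)
Lemma card_pred_values : #|pred_values m| = #|ascents m|.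
Proof.
have gt0 i : i \in ascents m -> 0 < m i by rewrite inE; apply: leq_ltn_trans.
rewrite -[RHS](card_in_imset (f := fun i => inord (m i).-1 : 'I_n.+1)).
  congr #|pred_of_set _|; apply/setP=> x; apply/pred_valuesP/imsetP.
    case=> i mi; have [|j Aj mj] := @value_at_ascent i; first by rewrite mi.
    by exists j => //; apply: val_inj; rewrite /= inord_pred mj mi.
  by case=> i /gt0 mi ->; exists i; rewrite inord_pred prednK.
move=> i j Ai Aj /(congr1 val); rewrite /= !inord_pred => e.
apply: ascents_inj => //; apply: val_inj => /=.
by have := gt0 i Ai; have := gt0 j Aj; lia.
Qed.

End Monotone.

(* Two nondecreasing functions with the same values and the same ascents
   agree: after an ascent each takes the least value above the previous one. *)
Lemma eq_from_values_ascents m m' :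
  (forall i j, i <= j -> m i <= m j) -> (forall i j, i <= j -> m' i <= m' j) ->
  m ord0 = 0 :> nat -> m' ord0 = 0 :> nat ->
  pred_values m = pred_values m' -> ascents m = ascents m' -> m = m'.
Proof.
have next (f g : {ffun 'I_n.+1 -> 'I_n.+1}) i :
    (forall i j, i <= j -> f i <= f j) -> pred_values f = pred_values g ->
    f (inord i.-1) < g i -> f i <= g i.
  move=> mf fg lt; have g0 : 0 < g i by apply: leq_ltn_trans lt.
  pose x : 'I_n.+1 := inord (g i).-1.
  have xE : x.+1 = g i by rewrite inord_pred prednK.
  have /pred_valuesP[j fj] : x \in pred_values f.
    by rewrite fg; apply/pred_valuesP; exists i.
  rewrite xE in fj; rewrite -fj; apply: (mf); rewrite leqNgt; apply/negP=> ji.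
  by have := mf j (inord i.-1); rewrite inord_pred fj; lia.
move=> mono mono' m0 m0' ev ea; apply/ffunP=> i.
have [d id] : exists d, i = d :> nat by exists i.
elim: d i id => [|d IH] i id.
  by rewrite (_ : i = ord0); apply: val_inj => //=; rewrite m0 m0'.
have e : m (inord i.-1) = m' (inord i.-1) by apply: IH; rewrite inord_pred id.
have : (i \in ascents m) = (i \in ascents m') by rewrite ea.
rewrite !inE => ai.
have le : m (inord i.-1) <= m i by apply: mono; rewrite inord_pred leq_pred.
have le' : m' (inord i.-1) <= m' i by apply: mono'; rewrite inord_pred leq_pred.
apply: val_inj => /=; have [lt|ge] := boolP (m (inord i.-1) < m i); last first.
  by move: ge ai; rewrite -e in le' *; lia.
have lt' : m' (inord i.-1) < m' i by rewrite -ai.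
apply/eqP; rewrite eqn_leq !next //; first by rewrite -e.
by rewrite e.
Qed.

Lemma left_end_spec0 m : left_end_spec m -> m ord0 = 0 :> nat.
Proof. by case/left_end_specP=> _ /(_ ord0); rewrite leqn0 => /eqP. Qed.

Lemma pred_values_lt m x : left_end_spec m ->
  x \in pred_values m -> x < m ord_max.
Proof.
by case/left_end_specP=> mono _ _ /pred_valuesP[i <-]; apply: mono; rewrite -ltnS.
Qed.

Lemma ascents_ge m x : left_end_spec m -> x \in ascents m -> m ord_max <= x.
Proof.
case/left_end_specP=> _ _ m0; rewrite inE => lt; rewrite leqNgt; apply/negP=> /m0 mx.
by rewrite mx in lt.
Qed.

(** The last value of [m] cuts the code into its two constituents, so the code and this single
    number determine both. *)
Lemma pred_valuesE m : left_end_spec m ->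
  pred_values m = [set x in code m | x < m ord_max].
Proof.
move=> gm; apply/setP=> x; rewrite [RHS]inE in_setU.
have := @pred_values_lt m x gm; have := @ascents_ge m x gm.
by case: (x \in pred_values m); case: (x \in ascents m) => /=; lia.
Qed.

Lemma ascentsE m : left_end_spec m ->
  ascents m = [set x in code m | m ord_max <= x].
Proof.
move=> gm; apply/setP=> x; rewrite [RHS]inE in_setU.
have := @pred_values_lt m x gm; have := @ascents_ge m x gm.
by case: (x \in pred_values m); case: (x \in ascents m) => /=; lia.
Qed.

Lemma card_code m : left_end_spec m -> #|code m| = #|ascents m|.*2.
Proof.
move=> gm; have /left_end_specP[mono _ _] := gm.
rewrite cardsU card_pred_values //; last exact: left_end_spec0.
rewrite (_ : _ :&: _ = set0) ?cards0; first by lia.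
apply/setP=> x; rewrite in_setI in_set0; apply/negP=> /andP[].
by move=> /(pred_values_lt gm) + /(ascents_ge gm); lia.
Qed.

(** Two cuts of the same set might differ. The function with the larger cut has fewer ascents by
    inclusion, but both have half as many as the code has elements, so the ascents agree; the values
    agree likewise. *)
Lemma code_inj : {in [pred m | left_end_spec m] &, injective code}.
Proof.
suff wl m m' : left_end_spec m -> left_end_spec m' -> code m = code m' ->
    m ord_max <= m' ord_max -> m = m'.
  move=> m m'; rewrite !inE => gm gm' e.
  case: (leqP (m ord_max) (m' ord_max)) => [|/ltnW] le.
    exact: wl.
  by apply/esym/wl.
move=> gm gm' e le.
have cA : #|ascents m| = #|ascents m'|.
  by apply: double_inj; rewrite -!card_code ?e.
have eA : ascents m' = ascents m.
  apply/eqP; rewrite eqEcard cA leqnn andbT; apply/subsetP=> x.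
  by rewrite (ascentsE gm) (ascentsE gm') e !inE => /andP[-> /(leq_trans le)].
have /left_end_specP[mono _ _] := gm; have /left_end_specP[mono' _ _] := gm'.
have z := left_end_spec0 gm; have z' := left_end_spec0 gm'.
apply: eq_from_values_ascents => //; apply/eqP; rewrite eqEcard.
rewrite !card_pred_values // cA leqnn andbT; apply/subsetP=> x.
rewrite (pred_valuesE gm) (pred_valuesE gm') e !inE => /andP[-> /= lt].
exact: leq_trans lt le.
Qed.

Definition consecutive_pair (k : 'I_n) : {set 'I_n.+1} :=
  [set widen_ord (leqnSn n) k; lift ord0 k].

(** Such a code would have the single ascent k + 1 and the single positive value k + 1, hence m (k +
    1) = k + 1, against m i <= i - 1. *)
Lemma code_not_consecutive m k : left_end_spec m -> code m != consecutive_pair k.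
Proof.
move=> gm; apply/eqP=> e; have /left_end_specP[mono mpred _] := gm.
have m0 := left_end_spec0 gm.
set u : 'I_n.+1 := widen_ord (leqnSn n) k.
set v : 'I_n.+1 := lift ord0 k; have uE : u = k :> nat by [].
have vE : v = k.+1 :> nat by [].
have uv : u != v by apply/eqP=> /(congr1 (@nat_of_ord _)); rewrite uE vE; lia.
have cA : #|ascents m| = 1.
  by apply: double_inj; rewrite -card_code // e cards2 uv.
have cV : #|pred_values m| = 1 by rewrite card_pred_values.
have /cards1P[y yA] : #|ascents m| == 1 by rewrite cA.
have /cards1P[x xV] : #|pred_values m| == 1 by rewrite cV.
have yin : y \in ascents m by rewrite yA inE.
have xin : x \in pred_values m by rewrite xV inE.
have lt := pred_values_lt gm xin; have ge := ascents_ge gm yin.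
have in_pair z : z \in code m -> z = k :> nat \/ z = k.+1 :> nat.
  by rewrite e in_set2 => /orP[] /eqP ->; rewrite ?uE ?vE; [left|right].
have xk : x \in code m by rewrite inE xin.
have yk : y \in code m by rewrite inE yin orbT.
have [yE xE] : y = k.+1 :> nat /\ x = k :> nat.
  by have := in_pair x xk; have := in_pair y yk; lia.
have my : 0 < m y by move: yin; rewrite inE; apply: leq_ltn_trans.
have /pred_valuesP[i mi] := xin.
have [|j] := @value_at_ascent m mono m0 i; first by rewrite mi.
rewrite yA inE => /eqP -> myi; have := mpred y; rewrite myi mi; lia.
Qed.

End Code.

(** * Order statistics of a finite set *)

Section Rank.
Variables (n : nat) (A : {set 'I_n.+1}).

Definition rank (v : nat) : nat := #|[set x in A | x < v]|.

Lemma rank_le u v : u <= v -> rank u <= rank v.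
Proof.
move=> uv; apply/subset_leq_card/subsetP=> x; rewrite !inE => /andP[-> /=].
by move/leq_trans; apply.
Qed.

Lemma rank0 : rank 0 = 0.
Proof. by apply/eqP; rewrite cards_eq0; apply/eqP/setP=> x; rewrite !inE andbF. Qed.

Lemma rankS (x : 'I_n.+1) : rank x.+1 = rank x + (x \in A).
Proof.
rewrite /rank (cardsD1 x) !inE ltnSn andbT addnC; congr (_ + _).
apply: eq_card => y; rewrite !inE -val_eqE /= ltnS ltn_neqAle.
by case: (y \in A); lia.
Qed.

Lemma rank_max : rank n.+1 = #|A|.
Proof. by apply: eq_card => x; rewrite !inE ltn_ord andbT. Qed.

(** The second disjunct makes [select] total: it takes the value n + 1 when r exceeds the size of
    [A]. *)
Lemma select_exists r : exists v, (r <= rank v) || (n.+1 <= v).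
Proof. by exists n.+1; rewrite leqnn orbT. Qed.

(* For 0 < r <= #|A|, one more than the r-th smallest element of [A]. *)
Definition select r := ex_minn (select_exists r).

Lemma select_ltn r v : v < select r -> rank v < r.
Proof.
rewrite /select; case: ex_minnP => u _ umin vu.
by rewrite ltnNge; apply/negP=> rv; have := umin v; rewrite rv => /(_ isT); lia.
Qed.

Lemma select_le_max r : select r <= n.+1.
Proof. by rewrite /select; case: ex_minnP => u _; apply; rewrite leqnn orbT. Qed.

Lemma select_le r v : r <= rank v -> select r <= v.
Proof.
by move=> rv; rewrite leqNgt; apply/negP=> /select_ltn; rewrite ltnNge rv.
Qed.

Lemma select0 : select 0 = 0.
Proof. by apply/eqP; rewrite -leqn0; apply: select_le. Qed.

Lemma rank_select_ge r : r <= #|A| -> r <= rank (select r).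
Proof.
move=> rA; rewrite /select; case: ex_minnP => u /orP[//|nu] _.
by apply: leq_trans rA _; rewrite -rank_max; apply: rank_le.
Qed.

(** The rank is below r at x and reaches r at x + 1, so x itself must be counted. *)
Lemma select_pred r x : r <= #|A| -> select r = x.+1 ->
  exists2 y : 'I_n.+1, y = x :> nat & y \in A.
Proof.
move=> rA sx; have xn : x < n.+1 by have := select_le_max r; rewrite sx.
exists (Ordinal xn) => //; have := rank_select_ge rA; rewrite sx.
have := rankS (Ordinal xn); have := @select_ltn r x; rewrite sx /=.
by case: (_ \in A) => //=; lia.
Qed.

Lemma rank_select r : r <= #|A| -> rank (select r) = r.
Proof.
move=> rA; have := rank_select_ge rA; case E: (select r) => [|x].
  by rewrite rank0; lia.
have [y yx yA] := select_pred rA E.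
by have := rankS y; have := @select_ltn r x; rewrite E yA yx; lia.
Qed.

Lemma select_mono r s : s <= #|A| -> r <= s -> select r <= select s.
Proof. by move=> sA rs; apply: select_le; rewrite rank_select. Qed.

Lemma select_lt r s : s <= #|A| -> r < s -> select r < select s.
Proof.
move=> sA rs; rewrite ltnNge; apply/negP=> /rank_le.
by rewrite !rank_select //; lia.
Qed.

Lemma select_rankS (x : 'I_n.+1) : x \in A -> select (rank x).+1 = x.+1.
Proof.
move=> xA; apply/eqP; rewrite eqn_leq select_le ?rankS ?xA ?addn1 //=.
have rx : (rank x).+1 = rank x.+1 by rewrite rankS xA addn1.
rewrite ltnNge; apply/negP=> /rank_le; rewrite rank_select ?ltnn //.
by rewrite rx -rank_max; apply: rank_le.
Qed.

End Rank.

Lemma consecutive_pair_inj n : injective (@consecutive_pair n).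
Proof.
move=> k l e; apply: val_inj => /=.
have : widen_ord (leqnSn n) k \in consecutive_pair l by rewrite -e !inE eqxx.
have : widen_ord (leqnSn n) l \in consecutive_pair k by rewrite e !inE eqxx.
by rewrite !inE -!val_eqE /= /bump /=; lia.
Qed.

Lemma card_consecutive_pair n k : #|@consecutive_pair n k| = 2.
Proof. by rewrite cards2 -val_eqE /= /bump /= neq_ltn ltnSn. Qed.

(** * Decoding an even subset *)

Section Surjective.
Variables (n : nat) (A : {set 'I_n.+1}).
Hypothesis evenA : ~~ odd #|A|.
Hypothesis nconsA : forall k, A != consecutive_pair k.

Let h := #|A|./2.
(** The cut: exactly half of [A] lies below it. *)
Let k := select A h.

Let hA : #|A| = h + h.
Proof. by rewrite addnn -[LHS]odd_double_half (negbTE evenA). Qed.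

Let rk : rank A k = h. Proof. by rewrite rank_select // hA leq_addr. Qed.

(** The truncated difference counts the elements of the larger half up to i, that is, the ascents so
    far; if there are r > 0 of them, the value is the r-th smallest element plus one. Below the cut
    it is 0. *)
Let dec (i : nat) := select A (rank A i.+1 - h).

Let rank_leA v : rank A v <= h + h.
Proof.
by rewrite -hA; apply/subset_leq_card/subsetP=> x; rewrite inE => /andP[].
Qed.

Let dec_lt i : i < k -> dec i = 0.
Proof.
move=> ik; rewrite /dec (_ : _ - h = 0) ?select0 //.
by have := rank_le A ik; rewrite rk; lia.
Qed.

Let dec_le i : dec i <= k.
Proof. by apply: select_mono; have := rank_leA i.+1; lia. Qed.

(** Below k the value is 0, and above k it is at most k. At i = k it can only fail if k is in [A]
    and h = 1, but then [A] would be the excluded pair {k - 1, k}. *)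
Let dec_pred (i : 'I_n.+1) : dec i <= i.-1.
Proof.
have [ik|ki|ik] := ltngtP i k; first by rewrite dec_lt.
  by have := dec_le i; lia.
have := rankS A i; rewrite {2}ik rk => rS.
rewrite /dec rS addKn; case: (boolP (i \in A)) => iA; last by rewrite select0.
have [h1|[h0|hE]] : 1 < h \/ h = 0 \/ h = 1 by lia.
- have lt : select A 1 < k by apply: select_lt => //; rewrite hA leq_addr.
  by rewrite /=; lia.
- by move: iA; rewrite (cards0_eq (A := A)) ?inE // hA h0.
case: (posnP i) => i0.
  by have := rk; rewrite -ik i0 rank0 hE.
have [y yi yA] : exists2 y : 'I_n.+1, y = i.-1 :> nat & y \in A.
  by apply: (@select_pred _ _ h); rewrite ?hA ?leq_addr // -/k -ik prednK.
have ln : i.-1 < n by have := ltn_ord i; lia.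
case/eqP: (nconsA (Ordinal ln)); apply/esym/eqP.
rewrite eqEcard hA hE card_consecutive_pair andbT.
apply/subsetP=> z; rewrite in_set2 => /orP[] /eqP ->.
  by rewrite (_ : widen_ord _ _ = y) //; apply: val_inj.
by rewrite (_ : lift _ _ = i) //; apply: val_inj; rewrite /= /bump /=; lia.
Qed.

Let m : {ffun 'I_n.+1 -> 'I_n.+1} := [ffun i : 'I_n.+1 => inord (dec i)].

Let mE i : m i = dec i :> nat.
Proof. by rewrite ffunE inordK //; have := dec_pred i; have := ltn_ord i; lia. Qed.

Let m_max : m ord_max = k :> nat.
Proof. by rewrite mE /dec rank_max hA addKn. Qed.

Let left_end_spec_m : left_end_spec m.
Proof.
apply/left_end_specP; split=> [i j ij|i|i].
- rewrite !mE; apply: select_mono; first by have := rank_leA j.+1; lia.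
  by apply: leq_sub2r; apply: rank_le.
- by rewrite mE.
- by rewrite m_max mE; apply: dec_lt.
Qed.

Let code_m : code m = A.
Proof.
have pv : pred_values m = [set x in A | x < k].
  apply/setP=> x; rewrite [RHS]inE; apply/pred_valuesP/andP => [[j]|[xA xk]].
    rewrite mE => di; have := dec_le j; rewrite di; split=> //.
    have [|y /val_inj -> //] := select_pred _ di.
    by have := rank_leA j.+1; lia.
  have rx : rank A x < h by rewrite -rk -addn1 -[1]/(true : nat) -xA -rankS rank_le.
  (* The value x + 1 has number [(rank A x).+1] among the positive values, so it is taken at the
     element of that number in the larger half, which is number s in [A]. *)
  pose s := h + (rank A x).+1; have sA : s <= #|A| by rewrite hA /s; lia.
  have : 0 < select A s.
    by rewrite -(select0 A); apply: select_lt => //; rewrite /s; lia.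
  case E: (select A s) => [//|i] _; have [y yi _] := select_pred sA E.
  exists y; rewrite mE /dec yi -E rank_select // /s addKn; exact: select_rankS.
have asc : ascents m = [set x in A | k <= x].
  apply/setP=> x; rewrite !inE !mE inord_pred.
  case: (posnP x) => [x0|x0].
    rewrite x0 ltnn; apply/esym/negP=> /andP[xA].
    rewrite leqn0 => /eqP k0; have := rk; rewrite k0 rank0 => h0.
    by move: xA; rewrite (cards0_eq (A := A)) ?inE // hA -h0.
  rewrite /dec prednK // rankS; case: (boolP (x \in A)) => xA /=; last first.
    by rewrite addn0 ltnn.
  have [kx|xk] := leqP k x.
    apply: select_lt; first by have := rank_leA x.+1; rewrite rankS xA; lia.
    by have := rank_le A kx; rewrite rk; lia.
  have rx : rank A x < h by rewrite -rk -addn1 -[1]/(true : nat) -xA -rankS rank_le.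
  by rewrite (_ : _ + _ - h = 0) ?select0 //=; lia.
rewrite /code pv asc; apply/setP=> x; rewrite !inE.
by case: (x \in A) => //=; lia.
Qed.

Lemma code_surj : exists2 m, left_end_spec m & code m = A.
Proof. by exists m. Qed.

End Surjective.

(** * The generating polynomial as a sum over even subsets *)

Local Open Scope ring_scope.

Lemma sum_even_sets (R : nzRingType) n :
  \sum_(A : {set 'I_n} | ~~ odd #|A|) 'X^(#|A|./2) = even_binom R n.
Proof.
apply/polyP=> i; rewrite coef_even_binom coef_sum.
under eq_bigr do rewrite coefXn.
rewrite -natr_sum -big_mkcondr /= sum1dep_card; congr _%:R.
rewrite -[n in RHS](card_ord n) -card_draws; apply: eq_card => A; rewrite !inE.
by apply/andP/eqP => [[oA /eqP ->]|->]; [rewrite even_halfK|rewrite odd_double doubleK].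
Qed.

Lemma conn_peak_polyE (R : realType) n :
  conn_peak_poly R n.+2 = 'X * peak_poly R n.+2.
Proof.
rewrite /conn_peak_poly.
have lle (m : {ffun 'I_n.+2 -> 'I_n.+2}) i : (left_end m i <= i)%N.
  by rewrite left_endE leq_subr.
transitivity (\sum_(m | @left_end_spec n.+1 m) 'X^(#|code m|./2.+1) : {poly R}).
  rewrite (reindex_onto (@left_end n.+1) (@left_end n.+1)) /=; last first.
    move=> a /and3P[/andP[/forallP ai _] _ _]; apply: left_endK => i.
    exact: ai.
  have spec (m : {ffun 'I_n.+2 -> 'I_n.+2}) :
    [&& area_sequence (left_end m), abelian_seq (left_end m)
      & connected_graph (left_end m)] = left_end_spec (left_end (left_end m)).
    by apply: left_end_specE.
  apply: eq_big => [m|m].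
    (* The specification gives m i <= i, hence the involution condition imposed by the
       reindexing. *)
    rewrite spec; apply/andP/idP => [[+ /eqP mK]|gm]; first by rewrite mK.
    have mK : left_end (left_end m) = m.
      apply: left_endK => i; have /left_end_specP[_ mp _] := gm.
      exact: leq_trans (mp i) (leq_pred _).
    by rewrite mK eqxx.
  rewrite spec => /andP[+ /eqP mK]; rewrite mK => gm.
  rewrite peakE ?mK // card_code // doubleK card_imset_ffun //.
    by have /left_end_specP[] := gm.
  exact: left_end_spec0.
transitivity (\sum_(A : {set 'I_n.+2} | ~~ odd #|A| &&
    (A \notin (@consecutive_pair n.+1) @: setT)) 'X^(#|A|./2.+1) : {poly R}).
  rewrite -(big_imset (h := @code n.+1) (fun A => 'X^(#|A|./2.+1))) /=; last first.
    by move=> m m' gm gm'; apply: code_inj.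
  apply: eq_bigl => A; apply/imsetP/andP => [[m gm ->]|[oA nA]].
    rewrite card_code // odd_double; split=> //; apply/imsetP=> -[k _ /eqP].
    exact/negP/code_not_consecutive.
  have [|m gm <-] := code_surj oA; last by exists m.
  by move=> k; apply: contraNneq nA => ->; apply: imset_f.
rewrite mulrBr -sum_even_sets mulr_sumr.
under [X in _ = X - _]eq_bigr do rewrite -exprS.
(* Among all even sets, the n + 1 consecutive pairs contribute X^2 each, which is exactly the
   subtracted term. *)
rewrite [X in _ = X - _](bigID (fun A => A \in (@consecutive_pair n.+1) @: setT)) /=.
rewrite addrC -[LHS]addr0 -addrA; congr (_ + _).
apply/esym/eqP; rewrite subr_eq0; apply/eqP.
transitivity (\sum_(A in (@consecutive_pair n.+1) @: setT) 'X^2 : {poly R}).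
  apply: eq_big => A.
    rewrite andbC; case: (boolP (A \in _)) => //= /imsetP[k _ ->].
    by rewrite card_consecutive_pair.
  by move=> /andP[_ /imsetP[k _ ->]]; rewrite card_consecutive_pair.
rewrite sumr_const card_imset; last exact: consecutive_pair_inj.
by rewrite cardsT card_ord -scalerAr -expr2 scaler_nat.
Qed.

Theorem corollary4p11 (R : realType) (n : nat) :
  real_rooted (conn_peak_poly R n).
Proof.
case: n => [|[|n]]; first by left.
  (* On one vertex there is only one function, so the sum is a constant multiple of a single
     monomial. *)
  rewrite /conn_peak_poly; set c := [ffun i : 'I_1 => i].
  rewrite (eq_bigr (fun=> 'X^(peak c))); last first.
    move=> a _; rewrite (_ : a = c) //; apply/ffunP=> i.
    by rewrite (ord1 (a i)) (ord1 (c i)).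
  rewrite big_const iter_addr addr0 -mulr_natl; apply: real_rootedM.
    apply: real_rooted_size_le2; rewrite -polyC_natr.
    exact: leq_trans (size_polyC_leq1 _) _.
  elim: (peak c) => [|d IH].
    by apply: real_rooted_size_le2; rewrite size_poly1.
  rewrite exprS; apply: real_rootedM => //.
  by apply: real_rooted_size_le2; rewrite size_polyX.
rewrite conn_peak_polyE; apply: real_rootedM; last exact: peak_poly_real_rooted.
by apply: real_rooted_size_le2; rewrite size_polyX.
Qed.
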